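(* Let $\mathbb C$ be a regular unital category. Then $\mathbb C$ is algebraically cartesian closed if and only if any subobject $u:Y\rightarrowtail X$ in $\mathbb C$ has a centralizer.
   Context: For an object $Y$ of a category $\mathbb C$ with pullbacks of split epimorphisms, $Pt_Y\mathbb C$ (points over $Y$) has as objects the pairs $(f:X\to Y,\ s:Y\to X)$ with $f s=1_Y$, and as morphisms the maps over $Y$ commuting with the sections. For $h:X\to Y$, $h^*:Pt_Y\mathbb C\to Pt_X\mathbb C$ is the change of base functor given by pulling back along $h$. $\tau_Y:Y\to 1$ is the terminal map; $Pt_1\mathbb C=\mathbb C$ when $\mathbb C$ is pointed, and then $\tau_Y^*(Z)=(p_Y:Y\times Z\to Y,\ (1_Y,0))$. A category $\mathbb C$ is unital when it is pointed, finitely complete, and for all $X,Y$ the pair $(1_X,0):X\rightarrowtail X\times Y$, $(0,1_Y):Y\rightarrowtail X\times Y$ is jointly strongly epic. In a unital category, two maps $f:X\to Z$, $g:Y\to Z$ with the same codomain commute when there is a (necessarily unique) map $\phi:X\times Y\to Z$ (the cooperator) with $\phi(1_X,0)=f$ and $\phi(0,1_Y)=g$. The centralizer of a subobject $u:Y\rightarrowtail X$ is the largest subobject of $X$ commuting with $u$, i.e. the universal monomorphism commuting with $u$. A category $\mathbb C$ with products is algebraically cartesian closed when, for every object $Y$, the functor $\tau_Y^*:Pt_1\mathbb C\to Pt_Y\mathbb C$ has a right adjoint. *)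

(* Defs.v *)
From Stdlib Require Import ProofIrrelevance.

Set Implicit Arguments.
Unset Strict Implicit.
Unset Printing Implicit Defensive.

Declare Scope cat_scope.
Delimit Scope cat_scope with cat.

Record Category : Type := MkCategory {
  Ob :> Type;
  Hom : Ob -> Ob -> Type;
  idm : forall X, Hom X X;
  comp : forall X Y Z, Hom Y Z -> Hom X Y -> Hom X Z;
  comp_idl : forall X Y (f : Hom X Y), comp (idm Y) f = f;
  comp_idr : forall X Y (f : Hom X Y), comp f (idm X) = f;
  comp_assoc : forall W X Y Z (h : Hom Y Z) (g : Hom X Y) (f : Hom W X),
      comp h (comp g f) = comp (comp h g) f
}.

Arguments Hom {_} _ _.
Arguments idm {_} _.
Arguments comp {_ _ _ _} _ _.

Notation "g ∘ f" := (comp g f) (at level 40, left associativity) : cat_scope.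
Local Open Scope cat_scope.

Record Functor (C D : Category) : Type := MkFunctor {
  fobj :> C -> D;
  fmap : forall X Y : C, Hom X Y -> Hom (fobj X) (fobj Y);
  fmap_id : forall X : C, fmap (idm X) = idm (fobj X);
  fmap_comp : forall (X Y Z : C) (g : Hom Y Z) (f : Hom X Y),
      fmap (g ∘ f) = fmap g ∘ fmap f
}.

(* F is left adjoint to G: a bijection Hom (F X) A ~ Hom X (G A), natural in
   X and A. *)
Record Adjunction (C D : Category) (F : Functor C D) (G : Functor D C) : Type :=
  MkAdjunction {
  transpose : forall (X : C) (A : D), Hom (F X) A -> Hom X (G A);
  untranspose : forall (X : C) (A : D), Hom X (G A) -> Hom (F X) A;
  transposeK : forall (X : C) (A : D) (f : Hom (F X) A),
      untranspose (transpose f) = f;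
  untransposeK : forall (X : C) (A : D) (g : Hom X (G A)),
      transpose (untranspose g) = g;
  transpose_natl : forall (X X' : C) (A : D) (f : Hom (F X) A) (k : Hom X' X),
      transpose (f ∘ fmap F k) = transpose f ∘ k;
  transpose_natr : forall (X : C) (A A' : D) (f : Hom (F X) A) (k : Hom A A'),
      transpose (k ∘ f) = fmap G k ∘ transpose f
}.

Definition has_right_adjoint (C D : Category) (F : Functor C D) : Prop :=
  exists G : Functor D C, inhabited (Adjunction F G).

Definition mono (C : Category) (X Y : C) (m : Hom X Y) : Prop :=
  forall (W : C) (a b : Hom W X), m ∘ a = m ∘ b -> a = b.

Definition jointly_epic (C : Category) (A B Z : C)
    (f : Hom A Z) (g : Hom B Z) : Prop :=
  forall (W : C) (a b : Hom Z W), a ∘ f = b ∘ f -> a ∘ g = b ∘ g -> a = b.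

(* Jointly epic, and jointly left orthogonal to every monomorphism. *)
Definition jointly_strongly_epic (C : Category) (A B Z : C)
    (f : Hom A Z) (g : Hom B Z) : Prop :=
  jointly_epic f g /\
  forall (M N : C) (m : Hom M N) (h : Hom Z N) (a : Hom A M) (b : Hom B M),
    mono m -> m ∘ a = h ∘ f -> m ∘ b = h ∘ g ->
    exists d : Hom Z M, m ∘ d = h /\ d ∘ f = a /\ d ∘ g = b.

Definition is_coequalizer (C : Category) (A X Q : C)
    (a b : Hom A X) (q : Hom X Q) : Prop :=
  q ∘ a = q ∘ b /\
  forall (W : C) (k : Hom X W), k ∘ a = k ∘ b -> exists! l : Hom Q W, l ∘ q = k.

Definition regular_epi (C : Category) (X Q : C) (q : Hom X Q) : Prop :=
  exists (A : C) (a b : Hom A X), is_coequalizer a b q.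

Record Terminal (C : Category) : Type := MkTerminal {
  one : C;
  to_one : forall X : C, Hom X one;
  to_one_unique : forall (X : C) (f : Hom X one), f = to_one X
}.

Record ZeroObject (C : Category) : Type := MkZeroObject {
  zero : C;
  to_zero : forall X : C, Hom X zero;
  to_zero_unique : forall (X : C) (f : Hom X zero), f = to_zero X;
  from_zero : forall X : C, Hom zero X;
  from_zero_unique : forall (X : C) (f : Hom zero X), f = from_zero X
}.

Definition zero_map (C : Category) (O : ZeroObject C) (X Y : C) : Hom X Y :=
  from_zero O Y ∘ to_zero O X.

Record Pullback (C : Category) (X Y Z : C) (f : Hom X Z) (g : Hom Y Z) : Type :=
  MkPullback {
  pb_obj : C;
  pb_fst : Hom pb_obj X;
  pb_snd : Hom pb_obj Y;
  pb_square : f ∘ pb_fst = g ∘ pb_snd;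
  pb_lift : forall (W : C) (a : Hom W X) (b : Hom W Y),
      f ∘ a = g ∘ b -> Hom W pb_obj;
  pb_lift_fst : forall (W : C) (a : Hom W X) (b : Hom W Y) (e : f ∘ a = g ∘ b),
      pb_fst ∘ pb_lift e = a;
  pb_lift_snd : forall (W : C) (a : Hom W X) (b : Hom W Y) (e : f ∘ a = g ∘ b),
      pb_snd ∘ pb_lift e = b;
  pb_unique : forall (W : C) (u v : Hom W pb_obj),
      pb_fst ∘ u = pb_fst ∘ v -> pb_snd ∘ u = pb_snd ∘ v -> u = v
}.

(* Finite limits are given by a choice of terminal object and pullbacks. *)
Record FinitelyComplete (C : Category) : Type := MkFinitelyComplete {
  terminal : Terminal C;
  pullback : forall (X Y Z : C) (f : Hom X Z) (g : Hom Y Z), Pullback f g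
}.

Section Products.
Variables (C : Category) (L : FinitelyComplete C).

Definition prod_pullback (X Y : C) :
    Pullback (to_one (terminal L) X) (to_one (terminal L) Y) :=
  pullback L (to_one (terminal L) X) (to_one (terminal L) Y).

Definition prod_obj (X Y : C) : C := pb_obj (prod_pullback X Y).
Definition proj1m (X Y : C) : Hom (prod_obj X Y) X := pb_fst (prod_pullback X Y).
Definition proj2m (X Y : C) : Hom (prod_obj X Y) Y := pb_snd (prod_pullback X Y).

Lemma to_one_eq (W : C) (a b : Hom W (one (terminal L))) : a = b.
Proof.
  rewrite (to_one_unique a); symmetry; apply to_one_unique.
Qed.

Definition pair_map (W X Y : C) (a : Hom W X) (b : Hom W Y) :
    Hom W (prod_obj X Y) :=
  pb_lift (prod_pullback X Y) (to_one_eq _ _ : _ ∘ a = _ ∘ b).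

Lemma pair_map_fst (W X Y : C) (a : Hom W X) (b : Hom W Y) :
  proj1m X Y ∘ pair_map a b = a.
Proof. apply pb_lift_fst. Qed.

Lemma pair_map_snd (W X Y : C) (a : Hom W X) (b : Hom W Y) :
  proj2m X Y ∘ pair_map a b = b.
Proof. apply pb_lift_snd. Qed.

Lemma pair_map_unique (W X Y : C) (u v : Hom W (prod_obj X Y)) :
  proj1m X Y ∘ u = proj1m X Y ∘ v -> proj2m X Y ∘ u = proj2m X Y ∘ v -> u = v.
Proof. apply pb_unique. Qed.

End Products.

(* The second clause is about kernel pairs: R is any pullback of f along itself. *)
Definition regular (C : Category) : Prop :=
  inhabited (FinitelyComplete C) /\
  (forall (X Y : C) (f : Hom X Y) (R : Pullback f f),
     exists (Q : C) (q : Hom X Q), is_coequalizer (pb_fst R) (pb_snd R) q) /\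
  (forall (X Y Z : C) (f : Hom X Z) (g : Hom Y Z) (P : Pullback f g),
     regular_epi f -> regular_epi (pb_snd P)).

Section Unital.
Variables (C : Category) (L : FinitelyComplete C) (O : ZeroObject C).

Definition inl_map (X Y : C) : Hom X (prod_obj L X Y) :=
  pair_map L (idm X) (zero_map O X Y).
Definition inr_map (X Y : C) : Hom Y (prod_obj L X Y) :=
  pair_map L (zero_map O Y X) (idm Y).

Definition unital : Prop :=
  forall X Y : C, jointly_strongly_epic (inl_map X Y) (inr_map X Y).

Definition is_cooperator (X Y Z : C) (f : Hom X Z) (g : Hom Y Z)
    (phi : Hom (prod_obj L X Y) Z) : Prop :=
  phi ∘ inl_map X Y = f /\ phi ∘ inr_map X Y = g.

Definition commute (X Y Z : C) (f : Hom X Z) (g : Hom Y Z) : Prop :=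
  exists phi : Hom (prod_obj L X Y) Z, is_cooperator f g phi.

(* Universal among monomorphisms commuting with u only, not among arbitrary
   maps; the factorization through z is unique because z is monic. *)
Definition is_centralizer (X Y : C) (u : Hom Y X) (T : C) (z : Hom T X) : Prop :=
  mono z /\ commute z u /\
  forall (V : C) (v : Hom V X), mono v -> commute v u ->
    exists w : Hom V T, z ∘ w = v.

Definition has_centralizer (X Y : C) (u : Hom Y X) : Prop :=
  exists (T : C) (z : Hom T X), is_centralizer u z.

End Unital.

Section Points.
Variables (C : Category) (Y : C).

Record Point : Type := MkPoint {
  pt_obj : C;
  pt_map : Hom pt_obj Y;
  pt_sec : Hom Y pt_obj;
  pt_split : pt_map ∘ pt_sec = idm Y
}.

Record PointHom (P Q : Point) : Type := MkPointHom {
  pt_hom :> Hom (pt_obj P) (pt_obj Q);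
  pt_hom_map : pt_map Q ∘ pt_hom = pt_map P;
  pt_hom_sec : pt_hom ∘ pt_sec P = pt_sec Q
}.

Lemma PointHom_ext (P Q : Point) (a b : PointHom P Q) :
  pt_hom a = pt_hom b -> a = b.
Proof.
  destruct a as [a a1 a2], b as [b b1 b2]; simpl; intros e; subst b.
  f_equal; apply proof_irrelevance.
Qed.

Definition point_id (P : Point) : PointHom P P :=
  MkPointHom (comp_idr (pt_map P)) (comp_idl (pt_sec P)).

Lemma point_comp_map (P Q R : Point) (b : PointHom Q R) (a : PointHom P Q) :
  pt_map R ∘ (b ∘ a) = pt_map P.
Proof. now rewrite comp_assoc, !pt_hom_map. Qed.

Lemma point_comp_sec (P Q R : Point) (b : PointHom Q R) (a : PointHom P Q) :
  (b ∘ a) ∘ pt_sec P = pt_sec R.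
Proof. now rewrite <- comp_assoc, !pt_hom_sec. Qed.

Definition point_comp (P Q R : Point) (b : PointHom Q R) (a : PointHom P Q) :
    PointHom P R :=
  MkPointHom (point_comp_map b a) (point_comp_sec b a).

Definition Pt : Category.
Proof.
  refine (@MkCategory Point PointHom point_id point_comp _ _ _); intros;
    apply PointHom_ext; simpl.
  - apply comp_idl.
  - apply comp_idr.
  - apply comp_assoc.
Defined.

End Points.

Section ChangeOfBase.
Variables (C : Category) (L : FinitelyComplete C) (X Y : C) (h : Hom X Y).

Definition base_change_pb (P : Point Y) : Pullback h (pt_map P) :=
  pullback L h (pt_map P).

Lemma base_change_sec_eq (P : Point Y) :
  h ∘ idm X = pt_map P ∘ (pt_sec P ∘ h).
Proof. now rewrite comp_assoc, pt_split, comp_idl, comp_idr. Qed.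

Definition base_change_obj (P : Point Y) : Point X :=
  MkPoint (pb_lift_fst (base_change_pb P) (base_change_sec_eq P)).

Lemma base_change_map_eq (P Q : Point Y) (a : PointHom P Q) :
  h ∘ pb_fst (base_change_pb P) = pt_map Q ∘ (a ∘ pb_snd (base_change_pb P)).
Proof. rewrite comp_assoc, pt_hom_map; apply pb_square. Qed.

Definition base_change_map (P Q : Point Y) (a : PointHom P Q) :
    PointHom (base_change_obj P) (base_change_obj Q).
Proof.
  refine (@MkPointHom _ _ (base_change_obj P) (base_change_obj Q)
            (pb_lift (base_change_pb Q) (base_change_map_eq a)) _ _); simpl.
  - apply pb_lift_fst.
  - apply pb_unique; rewrite comp_assoc, ?pb_lift_fst, ?pb_lift_snd.
    + reflexivity.
    + now rewrite <- comp_assoc, pb_lift_snd, comp_assoc, pt_hom_sec.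
Defined.

Definition base_change : Functor (Pt Y) (Pt X).
Proof.
  refine (@MkFunctor (Pt Y) (Pt X) base_change_obj base_change_map _ _);
    intros; apply PointHom_ext; simpl; apply pb_unique;
    rewrite ?comp_assoc, ?pb_lift_fst, ?pb_lift_snd, ?comp_idl, ?comp_idr;
    try reflexivity.
  now rewrite <- !comp_assoc, pb_lift_snd.
Defined.

End ChangeOfBase.

Definition algebraically_cartesian_closed (C : Category)
    (L : FinitelyComplete C) : Prop :=
  forall Y : C, has_right_adjoint (base_change L (to_one (terminal L) Y)).

(* Main.v *)
Require Import Defs.
From Stdlib Require Import IndefiniteDescription.

(** For a point [(f : X -> Y, s)] over [Y] and an object [V], a morphism of
    points from [tau_Y^* V = (Y × V -> Y)] to [(f, s)] is a map
    [h : Y × V -> X] extending [s] along [(1, 0)] and satisfying [f h = p_Y].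
    In a unital category [h] is determined by its restriction
    [v = h (0, 1) : V -> X]; this [v] commutes with [s] and satisfies [f v = 0].
    Conversely the cooperator of such a [v] with [s] is automatically a map over
    [Y], since the injections are jointly epic.  Hence
    [Hom (tau_Y^* V, (f, s))] is the set of those [v : V -> X] with [f v = 0]
    that commute with [s] ([point_hom_zero], [point_hom_commute],
    [point_hom_inj], [point_hom_exists]), naturally in [V], and a value at
    [(f, s)] of a right adjoint to [tau_Y^*] is an object representing these
    maps.

    If the right adjoint exists, apply this to the point [(p_Y, (1, u))] on
    [Y × X]: the maps [V -> Y × X] in question are the [(0, v)] with [v]
    commuting with [u], so the representing object is a centralizer of [u].

    Conversely, the section [s] is monic, so it has a centralizer
    [z : T -> X], and the kernel of [f z] is the candidate representing object.
    A centralizer is universal among monomorphisms only, whereas [v] is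
    arbitrary.  Regularity bridges the gap: factor [v = m q] with [m] monic and
    [q] a regular epimorphism; then [q × Y] is again a regular epimorphism, the
    cooperator of [v] and [s] descends along it, and so [m] commutes with [s]
    and factors through [z] ([commute_factor_centralizer]). *)

Set Implicit Arguments.
Unset Strict Implicit.
Unset Printing Implicit Defensive.

Local Open Scope cat_scope.

(** * Adjunctions from universal arrows *)

Lemma transpose_counit_fmap (C D : Category) (F : Functor C D) (G : Functor D C)
    (adj : Adjunction F G) (V : C) (A : D) (g : Hom V (G A)) :
  transpose adj (untranspose adj (idm (G A)) ∘ fmap F g) = g.
Proof.
  now rewrite transpose_natl, untransposeK, comp_idl.
Qed.

(** The hypothesis gives, for each [A], a terminal object of the comma category
    of [F] over [A]; choosing one for every [A] yields the right adjoint. *)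
Lemma right_adjoint_of_universal_arrows (C D : Category) (F : Functor C D) :
  (forall A : D, exists (Z : C) (e : Hom (F Z) A),
     forall (V : C) (h : Hom (F V) A), exists! g : Hom V Z, e ∘ fmap F g = h) ->
  has_right_adjoint F.
Proof.
  intros H.
  pose (U := fun A => constructive_indefinite_description _ (H A)).
  pose (Z := fun A => proj1_sig (U A)).
  pose (E := fun A => constructive_indefinite_description _ (proj2_sig (U A))).
  pose (e := fun A => proj1_sig (E A) : Hom (F (Z A)) A).
  pose (T := fun A V h =>
    constructive_indefinite_description _ (proj2_sig (E A) V h)).
  pose (t := fun V A h => proj1_sig (T A V h) : Hom V (Z A)).
  assert (et : forall V A (h : Hom (F V) A), e A ∘ fmap F (t V A h) = h)
    by (intros V A h; exact (proj1 (proj2_sig (T A V h)))).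
  assert (tu : forall V A (h : Hom (F V) A) g, e A ∘ fmap F g = h -> t V A h = g)
    by (intros V A h; exact (proj2 (proj2_sig (T A V h)))).
  clearbody t; clear T; clearbody e; clear E; clearbody Z; clear U.
  unshelve refine (let G : Functor D C :=
    @MkFunctor D C Z (fun A B k => t _ _ (k ∘ e A)) _ _ in _).
  { intros A; apply tu. now rewrite fmap_id, comp_idl, comp_idr. }
  { intros A A' A'' k' k; apply tu.
    now rewrite fmap_comp, comp_assoc, et, <- !comp_assoc, et. }
  exists G; constructor.
  unshelve refine (@MkAdjunction C D F G t (fun V A g => e A ∘ fmap F g) _ _ _ _);
    simpl.
  - intros; apply et.
  - intros; now apply tu.
  - intros V V' A f k; apply tu. now rewrite fmap_comp, comp_assoc, et.
  - intros V A A' f k; apply tu.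
    now rewrite fmap_comp, comp_assoc, et, <- comp_assoc, et.
Qed.

(** * Zero maps and images *)

Section ZeroMaps.
Variables (C : Category) (O : ZeroObject C).

Lemma comp_zero (X Y Z : C) (f : Hom Y Z) :
  f ∘ zero_map O X Y = zero_map O X Z.
Proof.
  unfold zero_map. now rewrite comp_assoc, (from_zero_unique (f ∘ _)).
Qed.

Lemma zero_comp (X Y Z : C) (f : Hom X Y) :
  zero_map O Y Z ∘ f = zero_map O X Z.
Proof.
  unfold zero_map. now rewrite <- comp_assoc, (to_zero_unique (_ ∘ f)).
Qed.

(** The identity of the terminal object factors through the zero object, so
    the terminal object is initial as well. *)
Lemma from_one_eq_zero (L : FinitelyComplete C) (X : C)
    (a : Hom (one (terminal L)) X) : a = zero_map O _ X.
Proof.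
  rewrite <- (comp_idr a).
  rewrite (to_one_eq (idm (one (terminal L))) (zero_map O _ _)).
  apply comp_zero.
Qed.

End ZeroMaps.

Lemma regular_epi_epi (C : Category) (X Q : C) (q : Hom X Q) :
  regular_epi q -> forall (W : C) (a b : Hom Q W), a ∘ q = b ∘ q -> a = b.
Proof.
  intros (A & c & d & E & H) W a b e.
  assert (k : b ∘ q ∘ c = b ∘ q ∘ d) by now rewrite <- !comp_assoc, E.
  destruct (H W (b ∘ q) k) as (l & _ & u).
  rewrite <- (u a e). now apply u.
Qed.

(** The image is the coequalizer of the kernel pair of [v].  To see that the
    comparison [m] is monic, two maps identified by [m] are lifted along [q]
    after passing to a regular epimorphic cover of their domain; the lifts are
    identified by [v], hence by [q]. *)
Lemma image_factorization (C : Category) (L : FinitelyComplete C)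
    (HR : regular C) (V X : C) (v : Hom V X) :
  exists (I : C) (q : Hom V I) (m : Hom I X),
    regular_epi q /\ mono m /\ m ∘ q = v.
Proof.
  destruct HR as (_ & Hcoeq & Hstable).
  set (R := pullback L v v).
  destruct (Hcoeq _ _ _ R) as (I & q & Hq).
  assert (Rq : regular_epi q) by (do 3 eexists; exact Hq).
  destruct Hq as (Eq & Uq).
  destruct (Uq X v (pb_square R)) as (m & Em & _).
  exists I, q, m; split; [exact Rq | split; [| exact Em]].
  intros W a b Eab.
  set (P1 := pullback L q a).
  set (P2 := pullback L q (b ∘ pb_snd P1)).
  assert (R1 : regular_epi (pb_snd P1)) by now apply Hstable.
  assert (R2 : regular_epi (pb_snd P2)) by now apply Hstable.
  apply (regular_epi_epi R1), (regular_epi_epi R2).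
  rewrite <- (pb_square P1), <- (pb_square P2).
  assert (Ev : v ∘ (pb_fst P1 ∘ pb_snd P2) = v ∘ pb_fst P2).
  { rewrite <- Em, <- (comp_assoc m q (pb_fst P2)), (pb_square P2).
    rewrite <- comp_assoc, (comp_assoc q), (pb_square P1).
    now rewrite !comp_assoc, Eab. }
  rewrite <- comp_assoc.
  rewrite <- (pb_lift_fst R Ev).
  rewrite <- (pb_lift_snd R Ev) at 2.
  now rewrite !comp_assoc, Eq.
Qed.

(** * Commuting maps in a unital category *)

Section Commuting.
Variables (C : Category) (L : FinitelyComplete C) (O : ZeroObject C).

Lemma pair_map_comp (W' W X Y : C) (a : Hom W X) (b : Hom W Y) (k : Hom W' W) :
  pair_map L a b ∘ k = pair_map L (a ∘ k) (b ∘ k).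
Proof.
  apply pair_map_unique;
    now rewrite comp_assoc, ?pair_map_fst, ?pair_map_snd.
Qed.

Lemma pair_map_eta (W X Y : C) (k : Hom W (prod_obj L X Y)) :
  pair_map L (proj1m L X Y ∘ k) (proj2m L X Y ∘ k) = k.
Proof.
  apply pair_map_unique; now rewrite ?pair_map_fst, ?pair_map_snd.
Qed.

Definition times_right (X X' Y : C) (k : Hom X X') :
    Hom (prod_obj L X Y) (prod_obj L X' Y) :=
  pair_map L (k ∘ proj1m L X Y) (proj2m L X Y).

Lemma times_right_pair (W X X' Y : C) (k : Hom X X') (a : Hom W X)
    (b : Hom W Y) :
  times_right Y k ∘ pair_map L a b = pair_map L (k ∘ a) b.
Proof.
  unfold times_right.
  now rewrite pair_map_comp, <- comp_assoc, pair_map_fst, pair_map_snd.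
Qed.

Lemma times_right_inl (X X' Y : C) (k : Hom X X') :
  times_right Y k ∘ inl_map L O X Y = inl_map L O X' Y ∘ k.
Proof.
  unfold inl_map.
  now rewrite times_right_pair, pair_map_comp, zero_comp, comp_idl, comp_idr.
Qed.

Lemma times_right_inr (X X' Y : C) (k : Hom X X') :
  times_right Y k ∘ inr_map L O X Y = inr_map L O X' Y.
Proof.
  unfold inr_map. now rewrite times_right_pair, comp_zero.
Qed.

Lemma commute_comp (V Y X Z : C) (v : Hom V X) (u : Hom Y X) (g : Hom X Z) :
  commute L O v u -> commute L O (g ∘ v) (g ∘ u).
Proof.
  intros (phi & E1 & E2). exists (g ∘ phi).
  split; now rewrite <- comp_assoc, ?E1, ?E2.
Qed.

Lemma commute_precomp (V V' Y X : C) (v : Hom V X) (u : Hom Y X)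
    (k : Hom V' V) :
  commute L O v u -> commute L O (v ∘ k) u.
Proof.
  intros (phi & E1 & E2). exists (phi ∘ times_right Y k).
  split; rewrite <- comp_assoc.
  - now rewrite times_right_inl, comp_assoc, E1.
  - now rewrite times_right_inr.
Qed.

(** [k × Y] is the pullback of [k] along the projection to its codomain. *)
Lemma regular_epi_times_right (HR : regular C) (X X' Y : C) (k : Hom X X') :
  regular_epi k -> regular_epi (times_right Y k).
Proof.
  intros Rk.
  assert (sq : k ∘ proj1m L X Y = proj1m L X' Y ∘ times_right Y k)
    by (unfold times_right; now rewrite pair_map_fst).
  unshelve refine (let P : Pullback k (proj1m L X' Y) :=
    @MkPullback _ _ _ _ _ _ (prod_obj L X Y) (proj1m L X Y) (times_right Y k) sq
      (fun W a b _ => pair_map L a (proj2m L X' Y ∘ b)) _ _ _ in _).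
  - intros W a b e; apply pair_map_fst.
  - intros W a b e; cbv beta.
    now rewrite times_right_pair, e, pair_map_eta.
  - intros W a b e1 e2. apply pair_map_unique; [exact e1 |].
    apply (f_equal (fun x => proj2m L X' Y ∘ x)) in e2.
    unfold times_right in e2.
    now rewrite !comp_assoc, pair_map_snd in e2.
  - destruct HR as (_ & _ & Hstable). exact (Hstable _ _ _ _ _ P Rk).
Qed.

Hypothesis HU : unital L O.

(** The cooperator of [m q] and [u] takes equal values on pairs that [q × Y]
    identifies: such pairs differ only by elements of the kernel pair of
    [m q] in the first variable, and maps out of a product are determined by
    their values on the two summands. *)
Lemma commute_descend (HR : regular C) (V I Y X : C) (q : Hom V I)
    (m : Hom I X) (u : Hom Y X) :
  regular_epi q -> commute L O (m ∘ q) u -> commute L O m u.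
Proof.
  intros Rq (phi & E1 & E2).
  destruct (regular_epi_times_right HR Y Rq) as (A & c & d & Ecd & Ucd).
  assert (Ephi : phi ∘ c = phi ∘ d).
  { set (R := pullback L (m ∘ q) (m ∘ q)).
    assert (Eker : (m ∘ q) ∘ (proj1m L V Y ∘ c) = (m ∘ q) ∘ (proj1m L V Y ∘ d)).
    { apply (f_equal (fun x => m ∘ (proj1m L I Y ∘ x))) in Ecd.
      unfold times_right in Ecd.
      rewrite !(comp_assoc (proj1m L I Y)), pair_map_fst in Ecd.
      rewrite !comp_assoc in Ecd. rewrite !comp_assoc. exact Ecd. }
    assert (Esnd : proj2m L V Y ∘ c = proj2m L V Y ∘ d).
    { apply (f_equal (fun x => proj2m L I Y ∘ x)) in Ecd.
      unfold times_right in Ecd.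
      now rewrite !comp_assoc, pair_map_snd in Ecd. }
    assert (Epair : phi ∘ times_right Y (pb_fst R)
                    = phi ∘ times_right Y (pb_snd R)).
    { apply (proj1 (HU _ _)); rewrite <- !comp_assoc.
      - rewrite !times_right_inl, !comp_assoc, E1. apply pb_square.
      - now rewrite !times_right_inr. }
    rewrite <- (pair_map_eta c), <- (pair_map_eta d), <- Esnd.
    rewrite <- (pb_lift_fst R Eker).
    rewrite <- (pb_lift_snd R Eker) at 2.
    now rewrite <- !times_right_pair, !comp_assoc, Epair. }
  destruct (Ucd X phi Ephi) as (psi & Epsi & _).
  exists psi; split.
  - apply (regular_epi_epi Rq).
    now rewrite <- comp_assoc, <- times_right_inl, comp_assoc, Epsi.
  - now rewrite <- (times_right_inr _ q), comp_assoc, Epsi.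
Qed.

(** The image of a map commuting with [u] again commutes with [u], so the
    universal property of [z], which speaks of monomorphisms only, extends to
    arbitrary maps. *)
Lemma commute_factor_centralizer (HR : regular C) (X Y T V : C)
    (u : Hom Y X) (z : Hom T X) (v : Hom V X) :
  is_centralizer L O u z -> commute L O v u -> exists w : Hom V T, z ∘ w = v.
Proof.
  intros (_ & _ & Uz) Hv.
  destruct (image_factorization L HR v) as (I & q & m & Rq & Mm & Em).
  rewrite <- Em in Hv.
  destruct (Uz I m Mm (commute_descend HR Rq Hv)) as (w & Ew).
  exists (w ∘ q). now rewrite comp_assoc, Ew.
Qed.

(** * Morphisms of points out of a trivial point *)

Definition point_over_one (W : C) : Point (one (terminal L)) :=
  MkPoint (to_one_eq (to_one _ W ∘ zero_map O _ W) (idm _)).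

Lemma point_hom_over_one (V W : Point (one (terminal L)))
    (k : Hom (pt_obj V) (pt_obj W)) :
  exists a : PointHom V W, pt_hom a = k.
Proof.
  unshelve eexists (@MkPointHom _ _ V W k _ _).
  - apply to_one_eq.
  - now rewrite (from_one_eq_zero O (pt_sec W)), (from_one_eq_zero O (_ ∘ _)).
  - reflexivity.
Qed.

Section TrivialPoint.
Variable Y : C.

Notation pi := (base_change L (to_one (terminal L) Y)).

Definition base_change_inj (V : Point (one (terminal L))) :
    Hom (pt_obj V) (pt_obj (pi V)) :=
  pb_lift (base_change_pb L (to_one (terminal L) Y) V)
    (to_one_eq (_ ∘ zero_map O _ Y) (_ ∘ idm (pt_obj V))).

Lemma base_change_map_inj (V V' : Point (one (terminal L)))
    (g : PointHom V V') :
  pt_hom (fmap pi g : PointHom _ _) ∘ base_change_inj V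
  = base_change_inj V' ∘ pt_hom g.
Proof.
  unfold base_change_inj; simpl.
  apply pb_unique; rewrite !comp_assoc, ?pb_lift_fst, ?pb_lift_snd.
  - now rewrite zero_comp.
  - now rewrite <- comp_assoc, pb_lift_snd, comp_idl, comp_idr.
Qed.

(** Naturality in [V] of the restriction of point morphisms to [V]. *)
Lemma restriction_precomp (V V' : Point (one (terminal L))) (P : Point Y)
    (e : @Hom (Pt Y) (pi V') P) (g : @Hom (Pt (one (terminal L))) V V') :
  pt_hom (e ∘ fmap pi g : PointHom _ _) ∘ base_change_inj V
  = pt_hom (e : PointHom _ _) ∘ base_change_inj V' ∘ pt_hom (g : PointHom _ _).
Proof.
  rewrite <- comp_assoc, <- base_change_map_inj. symmetry. apply comp_assoc.
Qed.

(** The underlying object of [tau_Y^* V] is a product of [Y] and [V], with the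
    order of the factors and the choice of limit differing from
    [prod_obj L V Y]. *)
Definition to_prod (V : Point (one (terminal L))) :
    Hom (pt_obj (pi V)) (prod_obj L (pt_obj V) Y) :=
  pair_map L (pb_snd (base_change_pb L (to_one (terminal L) Y) V))
    (pb_fst (base_change_pb L (to_one (terminal L) Y) V)).

Definition of_prod (V : Point (one (terminal L))) :
    Hom (prod_obj L (pt_obj V) Y) (pt_obj (pi V)) :=
  pb_lift (base_change_pb L (to_one (terminal L) Y) V)
    (to_one_eq (_ ∘ proj2m L (pt_obj V) Y) (_ ∘ proj1m L (pt_obj V) Y)).

Lemma of_prodK (V : Point (one (terminal L))) :
  of_prod V ∘ to_prod V = idm _.
Proof.
  unfold of_prod, to_prod; simpl.
  apply pb_unique; rewrite !comp_assoc, ?pb_lift_fst, ?pb_lift_snd, comp_idr.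
  - apply pair_map_snd.
  - apply pair_map_fst.
Qed.

Lemma of_prod_inl (V : Point (one (terminal L))) :
  of_prod V ∘ inl_map L O (pt_obj V) Y = base_change_inj V.
Proof.
  unfold of_prod, inl_map, base_change_inj; simpl.
  apply pb_unique; rewrite !comp_assoc, ?pb_lift_fst, ?pb_lift_snd.
  - apply pair_map_snd.
  - apply pair_map_fst.
Qed.

Lemma of_prod_inr (V : Point (one (terminal L))) :
  of_prod V ∘ inr_map L O (pt_obj V) Y = pt_sec (pi V).
Proof.
  unfold of_prod, inr_map; simpl.
  apply pb_unique; rewrite !comp_assoc, ?pb_lift_fst, ?pb_lift_snd.
  - apply pair_map_snd.
  - rewrite (from_one_eq_zero O (pt_sec V)), zero_comp. apply pair_map_fst.
Qed.

Lemma to_prod_inj (V : Point (one (terminal L))) :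
  to_prod V ∘ base_change_inj V = inl_map L O (pt_obj V) Y.
Proof.
  unfold to_prod, base_change_inj, inl_map.
  now rewrite pair_map_comp, pb_lift_fst, pb_lift_snd.
Qed.

Lemma to_prod_sec (V : Point (one (terminal L))) :
  to_prod V ∘ pt_sec (pi V) = inr_map L O (pt_obj V) Y.
Proof.
  unfold to_prod, inr_map; simpl.
  rewrite pair_map_comp, pb_lift_fst, pb_lift_snd.
  now rewrite (from_one_eq_zero O (pt_sec V)), zero_comp.
Qed.

Lemma base_change_jointly_epic (V : Point (one (terminal L))) :
  jointly_epic (base_change_inj V) (pt_sec (pi V)).
Proof.
  intros W a b E1 E2.
  rewrite <- (comp_idr a), <- (comp_idr b), <- (of_prodK V), !comp_assoc.
  f_equal. apply (proj1 (HU _ _)); rewrite <- !comp_assoc.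
  - now rewrite of_prod_inl.
  - now rewrite of_prod_inr.
Qed.

Variables (V : Point (one (terminal L))) (P : Point Y).

Lemma point_hom_zero (h : PointHom (pi V) P) :
  pt_map P ∘ (pt_hom h ∘ base_change_inj V) = zero_map O _ _.
Proof.
  rewrite comp_assoc, pt_hom_map. unfold base_change_inj; simpl.
  apply pb_lift_fst.
Qed.

Lemma point_hom_commute (h : PointHom (pi V) P) :
  commute L O (pt_hom h ∘ base_change_inj V) (pt_sec P).
Proof.
  exists (pt_hom h ∘ of_prod V); split; rewrite <- comp_assoc.
  - now rewrite of_prod_inl.
  - rewrite of_prod_inr. apply pt_hom_sec.
Qed.

Lemma point_hom_inj (h h' : PointHom (pi V) P) :
  pt_hom h ∘ base_change_inj V = pt_hom h' ∘ base_change_inj V -> h = h'.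
Proof.
  intros E. apply PointHom_ext, (base_change_jointly_epic E).
  now rewrite !pt_hom_sec.
Qed.

(** The extension is the cooperator of [v] and the section; that it lies over
    [Y] is checked on the two injections. *)
Lemma point_hom_exists (v : Hom (pt_obj V) (pt_obj P)) :
  pt_map P ∘ v = zero_map O _ _ -> commute L O v (pt_sec P) ->
  exists h : PointHom (pi V) P, pt_hom h ∘ base_change_inj V = v.
Proof.
  intros Ev (phi & E1 & E2).
  assert (Einj : phi ∘ to_prod V ∘ base_change_inj V = v)
    by now rewrite <- comp_assoc, to_prod_inj.
  assert (Esec : phi ∘ to_prod V ∘ pt_sec (pi V) = pt_sec P)
    by now rewrite <- comp_assoc, to_prod_sec.
  unshelve refine (ex_intro _ (@MkPointHom _ _ (pi V) P
    (phi ∘ to_prod V) _ Esec) Einj).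
  apply base_change_jointly_epic; rewrite <- comp_assoc.
  - rewrite Einj, Ev. symmetry. apply pb_lift_fst.
  - now rewrite Esec, !pt_split.
Qed.

End TrivialPoint.

(** * The equivalence *)

Definition graph_point (X Y : C) (u : Hom Y X) : Point Y :=
  MkPoint (pair_map_fst L (idm Y) u).

(** The maps into [graph_point u] from trivial points are those of the form
    [(0, v)] with [v] commuting with [u], so the second projection turns the
    counit into the centralizer. *)
Lemma centralizer_of_right_adjoint (X Y : C) (u : Hom Y X) :
  has_right_adjoint (base_change L (to_one (terminal L) Y)) ->
  has_centralizer L O u.
Proof.
  intros (G & [adj]).
  set (P := graph_point u : Pt Y).
  set (e := untranspose adj (idm (G P))).
  set (j := pt_hom (e : PointHom _ _) ∘ base_change_inj Y (G P)).
  set (p := proj2m L Y X).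
  exists (pt_obj (G P)), (p ∘ j); split; [| split].
  - intros W a b Eab.
    destruct (point_hom_over_one (V := point_over_one W) (W := G P) a) as (ga & Ea).
    destruct (point_hom_over_one (V := point_over_one W) (W := G P) b) as (gb & Eb).
    subst a b. f_equal.
    rewrite <- (transpose_counit_fmap adj ga), <- (transpose_counit_fmap adj gb).
    f_equal. apply (point_hom_inj (P := graph_point u)).
    apply pair_map_unique.
    + etransitivity; [| symmetry]; apply (point_hom_zero (P := graph_point u)).
    + rewrite !restriction_precomp, !comp_assoc.
      unfold j in Eab. rewrite !comp_assoc in Eab. exact Eab.
  - rewrite <- (pair_map_snd L (idm Y) u).
    apply commute_comp. exact (point_hom_commute e).
  - intros V v _ Hv.
    set (w := pair_map L (zero_map O V Y) v).
    assert (Hw : commute L O w (pt_sec (graph_point u))).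
    { destruct Hv as (phi & E1 & E2).
      exists (pair_map L (proj2m L V Y) phi).
      split; unfold w; rewrite pair_map_comp, ?E1, ?E2; simpl; f_equal;
        apply pair_map_snd. }
    destruct (@point_hom_exists Y (point_over_one V) (graph_point u) w
      (pair_map_fst L _ _) Hw) as (h & Eh).
    set (g := transpose adj (h : @Hom (Pt Y) _ P)).
    assert (Eg : e ∘ fmap _ g = (h : @Hom (Pt Y) _ P)).
    { rewrite <- (transposeK adj (e ∘ _)). unfold e.
      rewrite transpose_counit_fmap. apply transposeK. }
    exists (pt_hom (g : PointHom _ _)).
    pose proof (restriction_precomp e g) as Er.
    rewrite Eg in Er.
    pose proof (eq_trans (eq_sym Eh) Er) as Ew.
    rewrite <- comp_assoc. etransitivity; [exact (f_equal (comp p) (eq_sym Ew)) |].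
    apply pair_map_snd.
Qed.

Lemma section_mono (Y : C) (P : Point Y) : mono (pt_sec P).
Proof.
  intros W a b E.
  apply (f_equal (fun x => pt_map P ∘ x)) in E.
  now rewrite !comp_assoc, pt_split, !comp_idl in E.
Qed.

(** The object representing the maps [v] with [f v = 0] that commute with the
    section is the intersection of the kernel of [f] with the centralizer of the
    section. *)
Lemma right_adjoint_of_centralizers (HR : regular C) (Y : C) :
  (forall (X : C) (s : Hom Y X), mono s -> has_centralizer L O s) ->
  has_right_adjoint (base_change L (to_one (terminal L) Y)).
Proof.
  intros H. apply right_adjoint_of_universal_arrows. intros P.
  destruct (H _ _ (section_mono (P := P))) as (T & z & Hz).
  pose proof (proj1 Hz) as Mz. pose proof (proj1 (proj2 Hz)) as Cz.
  set (K := pullback L (pt_map P ∘ z) (from_zero O Y)).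
  set (k := z ∘ pb_fst K).
  assert (Ek : pt_map P ∘ k = zero_map O _ _).
  { unfold k, zero_map. rewrite comp_assoc, (pb_square K).
    f_equal. apply to_zero_unique. }
  assert (Mk : mono k).
  { intros W a b E. unfold k in E. rewrite <- !comp_assoc in E.
    apply pb_unique; [exact (Mz _ _ _ E) |].
    now rewrite (to_zero_unique (_ ∘ a)), (to_zero_unique (_ ∘ b)). }
  set (Z := point_over_one (pb_obj K)).
  destruct (@point_hom_exists Y Z P k Ek (commute_precomp (pb_fst K) Cz))
    as (e & Ee).
  exists Z, e. intros V h.
  pose proof (point_hom_zero h) as Zh.
  destruct (commute_factor_centralizer HR Hz (point_hom_commute h)) as (w & Ew).
  assert (sq : (pt_map P ∘ z) ∘ w = from_zero O Y ∘ to_zero O (pt_obj V))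
    by now rewrite <- comp_assoc, Ew.
  destruct (point_hom_over_one (V := V) (W := Z) (pb_lift K sq)) as (g & Eg).
  exists g; split.
  - apply point_hom_inj. rewrite restriction_precomp, Ee.
    unfold k. rewrite Eg, <- comp_assoc, pb_lift_fst. exact Ew.
  - intros g' Eg'. apply PointHom_ext, Mk.
    transitivity (pt_hom h ∘ base_change_inj Y V).
    + unfold k. rewrite Eg, <- comp_assoc, pb_lift_fst. exact Ew.
    + now rewrite <- Eg', restriction_precomp, Ee.
Qed.

End Commuting.

Theorem proposition1p5 (C : Category) (L : FinitelyComplete C)
    (O : ZeroObject C) (HR : regular C) (HU : unital L O) :
  algebraically_cartesian_closed L <->
  (forall (X Y : C) (u : Hom Y X), mono u -> has_centralizer L O u).
Proof.
  split.
  - intros H X Y u _. exact (centralizer_of_right_adjoint HU u (H Y)).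
  - intros H Y. apply (right_adjoint_of_centralizers HU HR).
    intros X s. apply H.
Qed.
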